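(* Let $\mathbb{H}$ be a Banach space and let $E:\mathbb{H}\to[0,\infty)$ be a non-negative, lower semi-continuous functional. Suppose there is a constant $C>0$ such that $$\|\mathbf{x}-\mathbf{y}\|\le C\,(E(\mathbf{x})+E(\mathbf{y}))\quad\text{for all }\mathbf{x},\mathbf{y}\in\mathbb{H},$$ and suppose, in addition, that $\inf_{\mathbf{z}\in\mathbb{H}}E(\mathbf{z})=0$. Then $E$ has a unique minimizer, i.e. there is a unique $\overline{\mathbf{x}}\in\mathbb{H}$ such that $E(\overline{\mathbf{x}})=0$, and $$\|\mathbf{x}-\overline{\mathbf{x}}\|\le C\,E(\mathbf{x})\quad\text{for all }\mathbf{x}\in\mathbb{H}.$$ *)

(* Defs.v *)
From mathcomp Require Import all_boot all_order all_algebra.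

(* Main.v *)
Require Import Defs.
From mathcomp Require Import all_boot all_order all_algebra.
From mathcomp Require Import all_classical all_reals all_analysis.
Import Order.TTheory GRing.Theory Num.Theory.
Import numFieldNormedType.Exports.
Local Open Scope classical_set_scope.
Local Open Scope ring_scope.

(** Along a minimizing sequence [u], where [E (u n)] tends to [0], the bound
    [`|u m - u n| <= C * (E (u m) + E (u n))] makes [u] a Cauchy sequence
    ([cvg_dist_le_add]).  Its limit [xbar] exists by completeness, and lower
    semicontinuity gives [E xbar <= 0] ([lsc_le_lim]), so that [E xbar = 0].
    The remaining claims are the same bound read at the zero [xbar]: taking
    [y := xbar] gives the error estimate, and the error estimate at another
    zero of [E] gives uniqueness.  As [E >= 0 = E xbar], minimizers and zeros
    of [E] are the same points. *)

(** If the infimum were not a limit of values, some positive gap would separate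
    it from the whole range; [harmonic n] is the gap allowed at step [n]. *)
Lemma minimizing_sequence (R : realType) (T : pointedType) (f : T -> R) :
  has_lbound (range f) ->
  exists u : nat -> T, f (u n) @[n --> \oo] --> inf (range f).
Proof.
move=> lbf; have inff : has_inf (range f) by split=> //; exists (f point), point.
have near_inf (n : nat) : exists x, f x < inf (range f) + harmonic n.
  have [_ [x _ <-] fx] := inf_adherent (harmonic_gt0 n) inff.
  by exists x.
have [u fu] := boolp.choice near_inf; exists u.
apply: (@squeeze_cvgr _ _ _ _ (cst (inf (range f)))
                      (fun n => inf (range f) + harmonic n)).
- apply: nearW => n; apply/andP; split; last exact: ltW.
  by apply: ge_inf => //; exists (u n).
- exact: cvg_cst.
- rewrite -[X in _ --> X]addr0.
  by apply: cvgD; [exact: cvg_cst | exact: cvg_harmonic].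
Qed.

(** Once [a] is below [e / 2], any two values of [u] are within [e] of each
    other, so the image filter is Cauchy. *)
Lemma cvg_dist_le_add (R : realType) (V : completeNormedModType R) (T : Type)
    (F : set_system T) (FF : ProperFilter F) (u : T -> V) (a : T -> R) :
  a @ F --> 0 -> (forall s t, `|u s - u t| <= a s + a t) -> cvg (u @ F).
Proof.
move=> a0 ua; apply/cauchy_cvgP/cauchy_exP => e e0.
have small : \forall t \near F, a t < e / 2.
  by apply: cvgr_lt a0 _ _; rewrite divr_gt0.
have [s sa] := filter_ex small.
exists (u s); apply: filterS small => t ta /=.
rewrite -ball_normE /=; apply: le_lt_trans (ua s t) _.
by rewrite [ltRHS]splitr ltrD.
Qed.

(** If [l < f x], then [f] stays above a level strictly between [l] and [f x]
    near [x], which its values along [u] cannot do as they tend to [l]. *)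
Lemma lsc_le_lim (R : realType) (X : topologicalType) (f : X -> R) (T : Type)
    (F : set_system T) (FF : ProperFilter F) (u : T -> X) (x : X) (l : R) :
  lower_semicontinuous (fun z => (f z)%:E) ->
  u @ F --> x -> f (u t) @[t --> F] --> l -> f x <= l.
Proof.
move=> lscf ux ful; rewrite leNgt; apply/negP => lfx.
have [lm mfx] := midf_lt lfx.
have [W xW Wf] := lscf x ((l + f x) / 2) mfx.
have Wu : \forall t \near F, W (u t) by exact: ux.
have [t [Wt]] := filter_ex (filterI Wu (cvgr_lt l ful _ lm)).
by apply/negP; rewrite -leNgt -lee_fin ltW ?Wf.
Qed.

Theorem proposition1p2 (R : realType) (H : completeNormedModType R)
    (E : H -> R) (C : R)
    (E_ge0 : forall x : H, 0 <= E x)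
    (E_lsc : lower_semicontinuous (fun x : H => (E x)%:E))
    (C_gt0 : 0 < C)
    (E_bound : forall x y : H, `|x - y| <= C * (E x + E y))
    (E_inf : inf (range E) = 0) :
  exists xbar : H,
    [/\ unique (fun z : H => forall y : H, E z <= E y) xbar,
        unique (fun z : H => E z = 0) xbar &
        forall x : H, `|x - xbar| <= C * E x].
Proof.
have lbE : has_lbound (range E) by exists 0 => _ [x _ <-].
have [u] := minimizing_sequence _ _ E lbE; rewrite E_inf => Eu0.
have /cvg_ex[xbar uxbar] : cvg (u @ \oo).
  apply: (@cvg_dist_le_add _ _ _ _ _ u (fun n => C * E (u n))).
    by rewrite -[X in _ --> X](mulr0 C); apply: cvgM => //; exact: cvg_cst.
  by move=> m n; rewrite -mulrDr.
have Exbar : E xbar = 0.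
  by apply/eqP; rewrite eq_le E_ge0 (lsc_le_lim _ _ _ _ _ _ _ _ _ E_lsc uxbar).
have errxbar x : `|x - xbar| <= C * E x.
  by have := E_bound x xbar; rewrite Exbar addr0.
have zero_xbar z : E z = 0 -> xbar = z.
  move=> Ez; apply/esym/eqP; rewrite -subr_eq0 -normr_le0.
  by have := errxbar z; rewrite Ez mulr0.
exists xbar; split=> //; split=> //.
- by move=> y; rewrite Exbar.
- move=> z zmin; apply: zero_xbar; apply/eqP.
  by rewrite eq_le E_ge0 -[leRHS]Exbar zmin.
Qed.
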